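(* Let $y\in\operatorname{ran}(\mathbf A)$, let $(y_k)_k\in\mathbb Y^{\mathbb N}$ with $\|y_k-y\|\le\delta_k$, $\delta_k\to0$, let $\alpha_k\asymp\delta_k$, and set $\mathcal H_k=\frac12\|\mathbf A(\cdot)-y_k\|^2+\alpha_k\mathcal R$. For each $k$ let $(x_{k,n})_{n\in\mathbb N}$ be a sequence in $\mathbb X$ (the iterates of an iterative algorithm for minimizing $\mathcal H_k$) such that $\mathcal H_k(x_{k,n})\le\inf\mathcal H_k+f_k(n)$ with $f_k(n)\to0$ as $n\to\infty$. Let $(\eta_k)_k$ be a bounded sequence of nonnegative numbers and let $n(k)$ be such that $$\mathcal H_k(x_{k,n(k)})\le\inf_{z\in\mathbb X}\mathcal H_k(z)+\alpha_k\eta_k .$$ Suppose $(x_{k,n(k)})_k$ converges weakly to $x^\ddagger\in\mathbb X$, write $\Delta_k=\mathcal H_k(x_{k,n(k)})-\mathcal H_k(x^\ddagger)$, and assume: (C1) $G(x^\ddagger)\in\operatorname{ran}(\mathbf A^* )$; (C2) there are a real number $\varepsilon>\max\{0,\sup_k\Delta_k/\alpha_k\}$ and a constant $c$ such that $\mathcal R(x^\ddagger)-\mathcal R(z)\le c\,\|\mathbf A z-\mathbf A x^\ddagger\|$ for all $z\in\mathbb X$ with $|\mathcal R(x^\ddagger)-\mathcal R(z)|\le\varepsilon$. Then, as $k\to\infty$: (1) $\|\mathbf A x_{k,n(k)}-y_k\|=\mathcal O\bigl(\sqrt{\delta_k^2+\delta_k\eta_k}\bigr)$; (2) $D_G(x_{k,n(k)},x^\ddagger)=\mathcal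 O(\delta_k+\eta_k)$. If moreover $\eta_k\to0$, then $(x_{k,n(k)})_k$ converges to an $\mathcal R$-minimizing solution of $\mathbf A x=y$ in the Bregman-distance; that is, $x^\ddagger$ is an $\mathcal R$-minimizing solution of $\mathbf A x=y$ and $D_G(x_{k,n(k)},x^\ddagger)\to0$.
   Context: $\mathbb X,\mathbb Y$ are real Hilbert spaces and $\mathbf A\colon\mathbb X\to\mathbb Y$ is linear and bounded with adjoint $\mathbf A^*$. $\phi\colon\mathbb X\to[0,\infty)$ is a function. For $\mathcal R\colon\mathbb X\to\mathbb R$, an element $\xi\in\mathbb X$ is a $\phi$-relative subgradient of $\mathcal R$ at $x_0\in\mathbb X$ if $\mathcal R(x_0)+\langle\xi,x-x_0\rangle\le\mathcal R(x)+\phi(x)$ for all $x\in\mathbb X$; the set of these is denoted $\partial_\phi\mathcal R(x_0)$, and $\mathcal R$ is $\phi$-relatively subdifferentiable if $\partial_\phi\mathcal R(x)\ne\emptyset$ for all $x\in\mathbb X$. Standing assumptions: $\mathcal R\colon\mathbb X\to[0,\infty)$ is weakly lower semicontinuous, $\phi$-relatively subdifferentiable, and for every $\alpha>0$ and every $y^\delta\in\mathbb Y$ the functional $\frac12\|\mathbf A(\cdot)-y^\delta\|^2+\alpha\mathcal R$ is coercive (tends to $\infty$ as $\|x\|\to\infty$). $G\colon\mathbb X\to\mathbb X$ is a gradient selection for $\mathcal R$, i.e. $G(x)\in\partial_\phi\mathcal R(x)$ for all $x\in\mathbb X$. The Bregman-distance is $D_G(x,x_0)=\mathcal R(x)-\mathcal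 R(x_0)-\langle G(x_0),x-x_0\rangle$. An $\mathcal R$-minimizing solution of $\mathbf A x=y$ is an element $x^*$ with $\mathbf A x^*=y$ and $\mathcal R(x^* )=\inf\{\mathcal R(x):\mathbf A x=y\}$. The numbers $\delta_k,\alpha_k$ are positive, and $\alpha_k\asymp\delta_k$ means that there are constants $C_1,C_2>0$ with $C_1\delta_k\le\alpha_k\le C_2\delta_k$ for all sufficiently large $k$. *)

(* Defs.v *)
From HB Require Import structures.
From mathcomp Require Import all_boot all_order all_algebra sesquilinear.
From mathcomp Require Import all_classical all_reals all_analysis.

Set Implicit Arguments.
Unset Strict Implicit.
Unset Printing Implicit Defensive.

Import Order.TTheory GRing.Theory Num.Theory.
Import numFieldNormedType.Exports.

Local Open Scope classical_set_scope.
Local Open Scope ring_scope.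

HB.mixin Record NormedModule_hasInner (R : realType) X of NormedModule R X := {
  inner : {dot X for idfun} ;
  inner_normE : forall x : X, inner x x = `|x| ^+ 2
}.

(* Real Hilbert spaces: completeness is that of completeNormedModType, and the
   norm is the one induced by the inner product. *)
#[short(type="hilbertType")]
HB.structure Definition Hilbert (R : realType) :=
  {X of NormedModule_hasInner R X & CompleteNormedModule R X}.

Notation "''[' x , y ]" := (inner x y) (format "''[' x ,  y ]") : ring_scope.

Definition topological_dual (R : realType) (X : normedModType R) :=
  {f : {linear X -> R^o} | continuous f}.

(* The coarsest topology on X that makes all continuous linear functionals
   continuous. *)
Definition weak (R : realType) (X : normedModType R) :=
  sup_topology (fun f : topological_dual X =>
    Topological.class (initial_topology (sval f : X -> R^o))).

Section definitions.
Context {R : realType} {X Y : hilbertType R}.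
Implicit Types (A : X -> Y) (phi Reg : X -> R) (G : X -> X).

Definition is_adjoint A (Aadj : Y -> X) :=
  forall x y, '[A x, y] = '[x, Aadj y].

Definition relative_subdiff phi Reg (x0 : X) : set X :=
  [set xi | forall x, Reg x0 + '[xi, x - x0] <= Reg x + phi x].

Definition relatively_subdifferentiable phi Reg :=
  forall x, relative_subdiff phi Reg x !=set0.

Definition gradient_selection phi Reg G :=
  forall x, relative_subdiff phi Reg x (G x).

Definition weakly_lsc Reg := lower_semicontinuous (EFin \o Reg : weak X -> \bar R).

Definition weakly_cvg (u : nat -> X) (l : X) :=
  (u : nat -> weak X) @ \oo --> (l : weak X).

Definition coercive (F : X -> R) :=
  forall M : R, exists r : R, forall x, r <= `|x| -> M <= F x.

Definition tikhonov A Reg (alpha : R) (y : Y) (x : X) : R :=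
  2^-1 * `|A x - y| ^+ 2 + alpha * Reg x.

Definition bregman Reg G (x x0 : X) : R :=
  Reg x - Reg x0 - '[G x0, x - x0].

Definition minimizing_solution A Reg (y : Y) (x : X) :=
  A x = y /\ Reg x = inf [set Reg z | z in [set z | A z = y]].

Definition same_order (a d : nat -> R) :=
  exists C1 C2 : R, [/\ 0 < C1, 0 < C2 &
    \forall k \near \oo, C1 * d k <= a k <= C2 * d k].

End definitions.

(* Main.v *)
(* Write z_k for the stopped iterate and a_k = |A z_k - y_k|. Comparing H_k(z_k)
   with H_k(x) for A x = y gives
     a_k^2 / 2 + alpha_k Reg z_k <= delta_k^2 / 2 + alpha_k (Reg x + eta_k).
   Hence A z_k -> y, so A xd = y, and Reg z_k <= Reg x + O(delta_k) + eta_k.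
   Weak lower semicontinuity bounds Reg z_k from below, the gap between
   sup Delta_k / alpha_k and eps bounds it from above, so the variational
   inequality (C2) eventually applies to z_k. Inserted into the estimate with
   x = xd it makes the regularization gap linear in a_k + delta_k, and Young's
   inequality yields a_k^2 = O(delta_k^2 + delta_k eta_k). With G xd = Aadj w the
   linear part of the Bregman distance is <w, A z_k - y>, hence also of order
   a_k + delta_k. *)
Require Import Defs.
From HB Require Import structures.
From mathcomp Require Import all_boot all_order all_algebra sesquilinear.
From mathcomp Require Import all_classical all_reals all_analysis.
From mathcomp Require Import ring lra.

Set Implicit Arguments.
Unset Strict Implicit.
Unset Printing Implicit Defensive.

Import Order.TTheory GRing.Theory Num.Theory.
Import numFieldNormedType.Exports.

Local Open Scope classical_set_scope.
Local Open Scope ring_scope.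

(** * Inner products and weak convergence of sequences *)

Section inner_product.
Context {R : realType} {X : hilbertType R}.
Implicit Types x v : X.

Lemma innerC x v : '[x, v] = '[v, x].
Proof. by rewrite hermC expr0 mul1r. Qed.

Lemma inner_Zl (a : R) x v : '[a *: x, v] = a * '[x, v].
Proof. by rewrite linearZl_LR. Qed.

Lemma inner_Bl x x' v : '[x - x', v] = '[x, v] - '[x', v].
Proof. by rewrite linearBl. Qed.

(** The square of the norm of [|v|^2 x - <x, v> v] is nonnegative and equals
    [|v|^2 (|x|^2 |v|^2 - <x, v>^2)]. *)
Lemma inner_cauchy_schwarz x v : `|'[x, v]| <= `|x| * `|v|.
Proof.
have [->|v0] := eqVneq v 0; first by rewrite innerC linear0l !normr0 mulr0.
have v2 : 0 < `|v| ^+ 2 by rewrite exprn_gt0 ?normr_gt0.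
rewrite -(ler_pXn2r (n := 2)) ?nnegrE ?mulr_ge0// real_normK ?num_real//.
have := sqr_ge0 `|(`|v| ^+ 2) *: x - '[x, v] *: v|.
rewrite -inner_normE inner_Bl !inner_Zl !(innerC _ (_ - _)) !inner_Bl !inner_Zl.
rewrite !inner_normE (innerC v x) => h.
rewrite exprMn -subr_ge0 -(pmulr_rge0 _ v2); apply: le_trans h _.
by rewrite le_eqVlt; apply/orP; left; apply/eqP; ring.
Qed.

Lemma inner_linear v : linear (fun x => '[x, v] : R^o).
Proof. by move=> a x x'; rewrite linearDl/= inner_Zl. Qed.

Definition inner_functional v : X -> R^o := fun x => '[x, v].

HB.instance Definition _ v :=
  GRing.isLinear.Build R X R^o _ (inner_functional v) (inner_linear v).

Lemma inner_functional_continuous v : continuous (inner_functional v).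
Proof.
apply: bounded_linear_continuous; apply/linear_boundedP; near=> r => x.
rewrite (le_trans (inner_cauchy_schwarz _ _))// mulrC ler_wpM2r//.
Unshelve. all: by end_near. Qed.

(** Convergence in a supremum topology is convergence in each constituent, here the initial topology
    of the functional [<., v>]. *)
Lemma weakly_cvg_inner (u : nat -> X) (l v : X) :
  weakly_cvg u l -> (fun k => '[u k, v]) @ \oo --> '[l, v].
Proof.
move=> /cvg_sup ul.
pose f : topological_dual X :=
  exist _ (inner_functional v : {linear X -> R^o}) (@inner_functional_continuous v).
exact: (@cvg_comp _ _ _ (u : nat -> initial_topology (sval f : X -> R^o))
  (sval f) _ _ _ (ul f) (@initial_continuous _ _ (sval f : X -> R^o) l)).
Qed.

Lemma weakly_lsc_cvg (Reg : X -> R) (u : nat -> X) (l : X) (a : R) :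
  weakly_lsc Reg -> weakly_cvg u l -> a < Reg l ->
  \forall k \near \oo, a < Reg (u k).
Proof.
move=> lsc ul; rewrite -lte_fin => /(lsc l a)[V lV aV].
have : \forall k \near \oo, V (u k) by exact: ul.
by apply: filterS => k /aV; rewrite lte_fin.
Qed.

End inner_product.

(** * Near-minimizers of the Tikhonov functional and images of weak limits *)

Section tikhonov.
Context {R : realType} {X Y : hilbertType R}.

(** The functional is bounded below by 0, so its real [inf] is a genuine lower bound. *)
Lemma tikhonov_near_min (A : X -> Y) (Reg : X -> R) (a e : R) (yd : Y) (u x : X) :
  (forall x, 0 <= Reg x) -> 0 <= a ->
  tikhonov A Reg a yd u <= inf (range (tikhonov A Reg a yd)) + e ->
  tikhonov A Reg a yd u <= tikhonov A Reg a yd x + e.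
Proof.
move=> Reg0 a0 /le_trans; apply; rewrite lerD2r; apply: ge_inf; last by exists x.
by exists 0 => _ [v _ <-]; rewrite addr_ge0 ?mulr_ge0// ?invr_ge0 ?exprn_ge0.
Qed.

(** Through the adjoint, [<A (u k), w>] tends both to [<A l, w>] and to [<y, w>]; the choice
    [w = A l - y] gives [|w|^2 = 0]. *)
Lemma weak_limit_image (A : X -> Y) (Aadj : Y -> X) (u : nat -> X) (l : X) (y : Y) :
  is_adjoint A Aadj -> weakly_cvg u l -> (fun k => A (u k)) @ \oo --> y -> A l = y.
Proof.
move=> adj ul Auy; apply/eqP; rewrite -subr_eq0 -normr_eq0 -sqrf_eq0.
rewrite -inner_normE inner_Bl subr_eq0 adj; apply/eqP.
set w := A l - y.
have h1 := weakly_cvg_inner (v := Aadj w) ul.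
have h2 : (fun k => '[u k, Aadj w]) @ \oo --> '[y, w].
  under eq_fun do rewrite -adj.
  by apply: (cvg_comp _ (inner_functional w) Auy); exact: inner_functional_continuous.
exact: (cvg_unique _ h1 h2).
Qed.

End tikhonov.

Lemma residual_estimate (R : realFieldType) (a d al e c C : R) :
  0 <= a -> 0 <= d -> 0 <= al -> 0 <= e -> 0 <= c -> 0 <= C -> al <= C * d ->
  2^-1 * a ^+ 2 <= 2^-1 * d ^+ 2 + al * e + al * (c * (a + d)) ->
  a ^+ 2 <= 4 * (1 + C + C * c) ^+ 2 * (d ^+ 2 + d * e).
Proof.
move=> a0 d0 al0 e0 c0 C0 alC h.
have de0 : 0 <= d * e by rewrite mulr_ge0.
have Cc0 : 0 <= C * c by rewrite mulr_ge0.
have h1 : al * e <= C * d * e by rewrite ler_wpM2r.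
have h2 : al * (c * (a + d)) <= C * d * (c * (a + d)).
  by rewrite ler_wpM2r// mulr_ge0// addr_ge0.
(* Young's inequality, absorbing [C c d a] into [a^2 / 2]. *)
have h3 := sqr_ge0 (2^-1 * a - C * c * d).
(* After Young, [a^2 / 4] is at most [(1/2 + C c + (C c)^2) d^2 + C d e]; [h4] and [h5] are the
   surplus of [(1 + C + C c)^2] over these two coefficients. *)
have h4 : 0 <= (2^-1 + 2 * C + C ^+ 2 + C * c + 2 * C * (C * c)) * d ^+ 2.
  by rewrite mulr_ge0 ?sqr_ge0// !addr_ge0 ?mulr_ge0 ?sqr_ge0 ?invr_ge0.
have h5 : 0 <= (1 + C + C ^+ 2 + 2 * (C * c) + (C * c) ^+ 2 + 2 * C * (C * c)) * (d * e).
  by rewrite mulr_ge0// !addr_ge0 ?mulr_ge0 ?sqr_ge0.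
nra.
Qed.

Theorem corollary4p2 (R : realType) (X Y : hilbertType R)
    (A : {linear X -> Y}) (Aadj : Y -> X) (phi Reg : X -> R) (G : X -> X)
    (y : Y) (y_ : nat -> Y) (delta alpha eta : nat -> R)
    (x_ : nat -> nat -> X) (f : nat -> nat -> R) (n : nat -> nat) (xd : X) :
  let H k := tikhonov A Reg (alpha k) (y_ k) in
  let z k := x_ k (n k) in
  let Delta k := H k (z k) - H k xd in
  bounded_near A (nbhs 0) ->
  is_adjoint A Aadj ->
  (forall x, 0 <= phi x) ->
  (forall x, 0 <= Reg x) ->
  weakly_lsc Reg ->
  relatively_subdifferentiable phi Reg ->
  (forall (a : R) (yd : Y), 0 < a -> coercive (tikhonov A Reg a yd)) ->
  gradient_selection phi Reg G ->
  range A y ->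
  (forall k, 0 < delta k) ->
  (forall k, 0 < alpha k) ->
  (forall k, `|y_ k - y| <= delta k) ->
  delta @ \oo --> 0 ->
  same_order alpha delta ->
  (forall k m, H k (x_ k m) <= inf (range (H k)) + f k m) ->
  (forall k, f k @ \oo --> 0) ->
  (forall k, 0 <= eta k) ->
  bounded_fun eta ->
  (forall k, H k (z k) <= inf (range (H k)) + alpha k * eta k) ->
  weakly_cvg z xd ->
  range Aadj (G xd) ->
  (exists eps c : R,
    Num.max 0 (sup (range (fun k => Delta k / alpha k))) < eps /\
    forall x, `|Reg xd - Reg x| <= eps -> Reg xd - Reg x <= c * `|A x - A xd|) ->
  [/\ (fun k => `|A (z k) - y_ k| : R^o) =O_\oo
        (fun k => Num.sqrt (delta k ^+ 2 + delta k * eta k) : R^o),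
      (fun k => bregman Reg G (z k) xd : R^o) =O_\oo
        (fun k => delta k + eta k : R^o) &
      eta @ \oo --> 0 ->
        minimizing_solution A Reg y xd /\
        (fun k => bregman Reg G (z k) xd) @ \oo --> 0].
Proof.
move=> H z Delta _ adj _ Reg0 lsc _ _ _ [xp _ Axp] d0 al0 yd dcvg
  [C1 [C2 [C10 C20 alde]]] _ _ eta0 eta_bnd Hmin zxd [w _ Gw] [eps [c [epsP cond]]].
have [M etaM] : exists M, forall k, eta k <= M.
  have [M MP] := bounded_fun_has_ubound eta_bnd.
  by exists M => k; apply: MP; exists k.
have yd' k : `|y - y_ k| <= delta k by rewrite distrC.
have min_le k x : H k (z k) <= H k x + alpha k * eta k.
  exact: (tikhonov_near_min x Reg0 (ltW (al0 k)) (Hmin k)).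
have min_sol k x : A x = y ->
    2^-1 * `|A (z k) - y_ k| ^+ 2 + alpha k * Reg (z k) <=
    2^-1 * delta k ^+ 2 + alpha k * (Reg x + eta k).
  move=> Axy; have := min_le k x; rewrite /H /tikhonov Axy => /le_trans; apply.
  rewrite mulrDr addrA !lerD2r ler_wpM2l ?invr_ge0//.
  by rewrite ler_pXn2r ?nnegrE// ltW.
have Azy : (fun k => A (z k)) @ \oo --> y.
  (* [A xd = y] is not yet known, so the comparison is made with an arbitrary preimage [xp] of [y].
     The root bounds the residual, the added [delta k] the data error. *)
  pose b k := Num.sqrt (delta k * (delta k + 2 * C2 * (Reg xp + M))) + delta k.
  have bcvg : b @ \oo --> 0.
    rewrite -[0]addr0; apply: cvgD => //; rewrite -[X in _ --> X](@sqrtr0 R).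
    apply: (continuous_cvg _ (@sqrt_continuous R 0)).
    rewrite -[0](mul0r (0 + 2 * C2 * (Reg xp + M))); apply: cvgM => //.
    by apply: cvgD => //; exact: cvg_cst.
  suff : (fun k => `|A (z k) - y|) @ \oo --> 0 by move=> /norm_cvg0 /subr_cvg0.
  apply: squeeze_cvgr (cvg_cst 0) bcvg.
  near=> k; rewrite /= normr_ge0/=.
  rewrite -(subrKA (y_ k)) (le_trans (ler_normD _ _))// lerD//.
  rewrite -[leLHS]normr_id -sqrtr_sqr ler_wsqrtr//.
  have := min_sol k _ Axp.
  have /andP[_ al2] : C1 * delta k <= alpha k <= C2 * delta k by near: k.
  have h1 : 0 <= alpha k * Reg (z k) by rewrite mulr_ge0// ltW.
  have h2 : alpha k * (Reg xp + eta k) <= C2 * delta k * (Reg xp + M).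
    by rewrite ler_pM ?addr_ge0 ?lerD2l// ltW.
  by move=> h; lra.
have Axd : A xd = y := weak_limit_image adj zxd Azy.
(* Division of [min_sol] by [alpha k]; [C1 * delta k <= alpha k] turns [delta^2 / (2 alpha)] into
   [delta / (2 C1)]. *)
have Reg_upper x : A x = y ->
    \forall k \near \oo, Reg (z k) <= Reg x + (delta k / (2 * C1) + eta k).
  move=> Axy; near=> k.
  have /andP[al1 _] : C1 * delta k <= alpha k <= C2 * delta k by near: k.
  rewrite -(ler_pM2l (al0 k)).
  have h1 : 0 <= 2^-1 * `|A (z k) - y_ k| ^+ 2 by rewrite mulr_ge0 ?invr_ge0 ?sqr_ge0.
  have h2 : 2^-1 * delta k ^+ 2 <= alpha k * (delta k / (2 * C1)).
    rewrite mulrA ler_pdivlMr ?mulr_gt0//.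
    have := ler_wpM2r (ltW (d0 k)) al1; lra.
  have := min_sol k x Axy; lra.
have dC1 : (fun k => delta k / (2 * C1)) @ \oo --> 0.
  by rewrite -(mul0r (2 * C1)^-1); apply: cvgM => //; exact: cvg_cst.
have [eps0 seps] : 0 < eps /\ sup (range (fun k => Delta k / alpha k)) < eps.
  by move: epsP; rewrite gt_max => /andP[].
set s := sup _ in seps.
(* Near-minimality gives [Delta j / alpha j <= eta j <= M], so the supremum is over a set bounded
   above. *)
have Delta_le k : Delta k <= alpha k * s.
  rewrite mulrC -ler_pdivrMr//; apply: ub_le_sup; last by exists k.
  exists M => _ [j _ <-]; rewrite ler_pdivrMr// /Delta.
  have := min_le j xd; have := ler_wpM2l (ltW (al0 j)) (etaM j); lra.
(* As [eta] need not vanish here, [Reg_upper] is too weak for the bound from above; [Delta_le] gives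
   [Reg (z k) <= Reg xd + s + delta k / (2 C1)], and the last term eventually fits into
   [eps - s > 0]. *)
have Reg_close : \forall k \near \oo, `|Reg xd - Reg (z k)| <= eps.
  near=> k; rewrite ler_norml; apply/andP; split; last first.
    rewrite lerBlDr -lerBlDl ltW//; near: k.
    by apply: weakly_lsc_cvg zxd _ => //; rewrite ltrBlDr ltrDl.
  have /andP[al1 _] : C1 * delta k <= alpha k <= C2 * delta k by near: k.
  rewrite -(ler_pM2l (al0 k)).
  have := Delta_le k; rewrite /Delta /H /tikhonov Axd.
  have h1 : 0 <= 2^-1 * `|A (z k) - y_ k| ^+ 2 by rewrite mulr_ge0 ?invr_ge0 ?sqr_ge0.
  have h2 : 2^-1 * `|y - y_ k| ^+ 2 <= alpha k * (delta k / (2 * C1)).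
    have h3 : `|y - y_ k| ^+ 2 <= delta k ^+ 2 by rewrite ler_pXn2r ?nnegrE// ltW.
    rewrite mulrA ler_pdivlMr ?mulr_gt0//.
    have := ler_wpM2r (ltW (d0 k)) al1; nra.
  have h3 : alpha k * (delta k / (2 * C1)) <= alpha k * (eps - s).
    rewrite ler_wpM2l ?ltW//; near: k; apply: cvgr_lt dC1 _ _.
    by rewrite subr_gt0.
  lra.
have Azd k : `|A (z k) - y| <= `|A (z k) - y_ k| + delta k.
  by rewrite -(subrKA (y_ k)) (le_trans (ler_normD _ _))// lerD2l.
(* The sign of [c] is not prescribed, while [residual_estimate] needs a nonnegative constant. *)
pose c' := `|c|.
have Reg_lower : \forall k \near \oo,
    Reg xd - Reg (z k) <= c' * (`|A (z k) - y_ k| + delta k).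
  near=> k; have /cond : `|Reg xd - Reg (z k)| <= eps by near: k.
  move=> /le_trans; apply; rewrite Axd.
  by rewrite (le_trans (ler_wpM2r _ (ler_norm c)))// ler_wpM2l ?normr_ge0.
pose K := 4 * (1 + C2 + C2 * c') ^+ 2.
have K0 : 0 <= K by rewrite mulr_ge0 ?sqr_ge0.
have c'0 : 0 <= c' by exact: normr_ge0.
have residual : \forall k \near \oo, `|A (z k) - y_ k| <=
    Num.sqrt K * Num.sqrt (delta k ^+ 2 + delta k * eta k).
  near=> k; have /andP[_ al2] : C1 * delta k <= alpha k <= C2 * delta k by near: k.
  rewrite -sqrtrM// -[leLHS]normr_id -sqrtr_sqr ler_wsqrtr//.
  apply: (residual_estimate (al := alpha k));
    rewrite ?(ltW (d0 k)) ?(ltW (al0 k)) ?(ltW C20)//.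
  have /(ler_wpM2l (ltW (al0 k))) :
    Reg xd - Reg (z k) <= c' * (`|A (z k) - y_ k| + delta k) by near: k.
  have := min_sol k xd Axd; lra.
have sqrt_le k : Num.sqrt (delta k ^+ 2 + delta k * eta k) <= delta k + eta k.
  rewrite -[leRHS]ger0_norm; last by rewrite addr_ge0// ltW.
  rewrite -sqrtr_sqr ler_wsqrtr//.
  have := mulr_ge0 (ltW (d0 k)) (eta0 k); have := sqr_ge0 (eta k); nra.
(* The first two terms come from [Reg_upper], [c'] from [Reg_lower], [|w|] from the source
   condition; [Num.sqrt K + 1] bounds residual plus noise by [delta k + eta k]. *)
pose L := (2 * C1)^-1 + 1 + (c' + `|w|) * (Num.sqrt K + 1).
have L0 : 0 < L.
  by rewrite ltr_pwDl ?mulr_ge0 ?addr_ge0// addr_gt0// invr_gt0 mulr_gt0.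
(* A [phi]-relative subgradient allows negative Bregman distances, so both signs are estimated. *)
have breg : \forall k \near \oo,
    `|bregman Reg G (z k) xd| <= L * (delta k + eta k).
  near=> k; pose r := `|A (z k) - y_ k| + delta k.
  have r0 : 0 <= r by rewrite addr_ge0// ltW.
  have rle : r <= (Num.sqrt K + 1) * (delta k + eta k).
    rewrite mulrDl mul1r lerD ?lerDl//.
    have : `|A (z k) - y_ k| <=
      Num.sqrt K * Num.sqrt (delta k ^+ 2 + delta k * eta k) by near: k.
    by move=> /le_trans; apply; rewrite ler_wpM2l ?sqrtr_ge0.
  have inner_le : `|'[G xd, z k - xd]| <= `|w| * r.
    rewrite -Gw innerC -adj linearB/= Axd mulrC.
    by rewrite (le_trans (inner_cauchy_schwarz _ _))// ler_wpM2r.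
  have lower : Reg xd - Reg (z k) <= c' * r by rewrite /r; near: k.
  have upper : Reg (z k) <= Reg xd + (delta k / (2 * C1) + eta k).
    by near: k; exact: Reg_upper.
  have h1 : (c' + `|w|) * r <=
      (c' + `|w|) * (Num.sqrt K + 1) * (delta k + eta k).
    by rewrite -mulrA ler_wpM2l ?addr_ge0.
  have h2 : 0 <= eta k / (2 * C1) by rewrite divr_ge0// mulr_ge0// ltW.
  have h3 : 0 <= delta k / (2 * C1) by rewrite divr_ge0 ?(ltW (d0 k))// mulr_ge0// ltW.
  have h4 : 0 <= c' * r by rewrite mulr_ge0.
  have h5 : 0 <= `|w| * r by rewrite mulr_ge0.
  have e0 := eta0 k; have dk0 := d0 k.
  move: inner_le; rewrite /bregman ler_norml => /andP[i1 i2].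
  rewrite ler_norml /L; apply/andP; split; lra.
split.
- apply/eqO_exP; exists (Num.sqrt K + 1); first by rewrite ltr_wpDl ?sqrtr_ge0.
  near=> k; rewrite normr_id ger0_norm ?sqrtr_ge0// mulrDl.
  by rewrite ler_wpDr ?mulr_ge0 ?sqrtr_ge0//; near: k.
- apply/eqO_exP; exists L => //; near=> k.
  have de0 : 0 <= delta k + eta k by rewrite addr_ge0// ltW.
  by rewrite (ger0_norm de0); near: k.
- move=> etacvg.
  (* If [Reg x < Reg xd], then eventually [Reg (z k)] lies above their midpoint by weak lower
     semicontinuity and below it by [Reg_upper], since [eta] now vanishes. *)
  have Reg_min x : A x = y -> Reg xd <= Reg x.
    move=> Axy; rewrite leNgt; apply/negP => ltx.
    have lower : \forall k \near \oo, (Reg x + Reg xd) / 2 < Reg (z k).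
      by apply: weakly_lsc_cvg zxd _ => //; lra.
    have small : \forall k \near \oo,
        delta k / (2 * C1) + eta k < (Reg xd - Reg x) / 2.
      apply: cvgr_lt (cvgD dC1 etacvg) _ _; lra.
    have [k [[h1 h2] h3]] := filter_ex (filterI (filterI lower small) (Reg_upper x Axy)).
    by move: h1 h2 h3; clear; lra.
  split.
    split=> //; apply/le_anti/andP; split.
      by apply: lb_le_inf; [exists (Reg xd), xd | move=> _ [x /= Axy <-]; exact: Reg_min].
    by apply: ge_inf; [exists 0 => _ [x _ <-] | exists xd].
  have Lcvg : (fun k => L * (delta k + eta k)) @ \oo --> 0.
    have -> : 0 = L * (0 + 0) :> R by rewrite addr0 mulr0.
    by apply: cvgM (cvg_cst L) _; exact: cvgD.
  suff : (fun k => `|bregman Reg G (z k) xd|) @ \oo --> 0 by move=> /norm_cvg0.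
  apply: squeeze_cvgr (cvg_cst 0) Lcvg.
  by near=> k; rewrite /= normr_ge0/=; near: k.
Unshelve. all: by end_near. Qed.
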